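(* Let $P$ be a polynomial, let $n\in\mathbb{N}$, let $\bar F\colon\mathbb{R}^{n+1}\to\mathbb{R}$, and consider the equation $$P(\partial_x)u_t = F(u) = \bar F(u,\partial_x u,\ldots,\partial_x^n u).$$ Assume that this equation admits at most one classical solution $u(t,x)$ for given initial data $u(0,x)$. Suppose that either (a) $P$ is even and $\bar F(a_0,-a_1,a_2,-a_3,\ldots) = -\bar F(a_0,a_1,a_2,a_3,\ldots)$ for all $a_i\in\mathbb{R}$; or (b) $P$ is odd and $\bar F(a_0,-a_1,a_2,-a_3,\ldots) = \bar F(a_0,a_1,a_2,a_3,\ldots)$ for all $a_i\in\mathbb{R}$. Then any $x$-symmetric classical solution of the equation is a traveling wave solution.
   Context: $u=u(t,x)$ is a real-valued function of time $t\ge 0$ and $x\in\mathbb{R}$; $\mathbb{R}_+=(0,\infty)$; $P$ has real coefficients. A classical solution is a smooth function satisfying the equation pointwise. The sign pattern in conditions (a) and (b) means that the $i$-th argument $a_i$ is replaced by $(-1)^i a_i$, $i=0,\ldots,n$. A solution $u$ is called $x$-symmetric if there exists a function $\lambda\in C^1(\mathbb{R}_+)$ such that for every $t>0$, $u(t,x)=u(t,2\lambda(t)-x)$ for almost every $x\in\mathbb{R}$. A traveling wave solution is a solution of the form $u(t,x)=U(x-ct)$ for some constant $c\in\mathbb{R}$ and some function $U\colon\mathbb{R}\to\mathbb{R}$. *)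

(* Defs.v *)
From HB Require Import structures.
From mathcomp Require Import all_boot all_order all_algebra.
From mathcomp Require Import all_classical all_reals all_analysis.
Set Implicit Arguments.
Unset Strict Implicit.
Unset Printing Implicit Defensive.
Import Order.TTheory GRing.Theory Num.Theory.
Import numFieldNormedType.Exports.
Local Open Scope classical_set_scope.
Local Open Scope ring_scope.

(* A function u(t,x) of t >= 0 and x in R is encoded as u : R -> R -> R whose
   values at t < 0 are irrelevant: every notion below depends only on the
   restriction of u to the closed half-plane t >= 0. *)

Section HalfPlane.
Variable R : realType.
Implicit Types (u : R -> R -> R) (f : R -> R) (t x : R).

(* Increments h keep h + t in [0, +oo[, so this is the usual partial derivative
   when t > 0 and the right derivative when t = 0. *)
Definition time_increments t : set_system R :=
  within [set h | 0 <= h + t] (0 : R)^'.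

Definition time_quotient u t x (h : R) : R := h^-1 * (u (h + t) x - u t x).

Definition time_derivable u t x : Prop :=
  cvg (time_quotient u t x @ time_increments t).

Definition time_derive u : R -> R -> R :=
  fun t x => lim (time_quotient u t x @ time_increments t).

Definition space_derivable u t x : Prop := derivable (u t) x 1.

Definition space_derive u : R -> R -> R := fun t => derive1 (u t).

Definition continuous_halfplane u : Prop :=
  {within [set z : R * R | 0 <= z.1], continuous (fun z : R * R => u z.1 z.2)}.

Fixpoint C_halfplane (m : nat) u : Prop :=
  continuous_halfplane u /\
  if m is m'.+1 then
    [/\ forall t x, 0 <= t -> time_derivable u t x,
        forall t x, 0 <= t -> space_derivable u t x,
        C_halfplane m' (time_derive u)
      & C_halfplane m' (space_derive u)]
  else True.

Definition smooth_halfplane u : Prop := forall m, C_halfplane m u.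

Definition poly_diff (P : {poly R}) f : R -> R :=
  fun x => \sum_(i < size P) P`_i * derive1n i f x.

Definition jet (n : nat) f x : 'rV[R]_n.+1 := \row_(k < n.+1) derive1n k f x.

Definition classical_solution (P : {poly R}) (n : nat)
    (F : 'rV[R]_n.+1 -> R) u : Prop :=
  smooth_halfplane u /\
  forall t x, 0 <= t -> poly_diff P (time_derive u t) x = F (jet n (u t) x).

Definition unique_classical_solutions (P : {poly R}) (n : nat)
    (F : 'rV[R]_n.+1 -> R) : Prop :=
  forall u v, classical_solution P F u -> classical_solution P F v ->
    (forall x, u 0 x = v 0 x) -> forall t x, 0 <= t -> u t x = v t x.

Definition even_polynomial (P : {poly R}) : Prop :=
  forall x, P.[- x] = P.[x].

Definition odd_polynomial (P : {poly R}) : Prop :=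
  forall x, P.[- x] = - P.[x].

Definition alternate_signs (n : nat) (a : 'rV[R]_n.+1) : 'rV[R]_n.+1 :=
  \row_(k < n.+1) ((-1) ^+ k * a ord0 k).

Definition C1_positive (lambda : R -> R) : Prop :=
  {in `]0, +oo[, forall t, derivable lambda t 1} /\
  {in `]0, +oo[, continuous (derive1 lambda)}.

Definition x_symmetric u : Prop :=
  exists2 lambda : R -> R, C1_positive lambda &
    forall t, 0 < t ->
      {ae lebesgue_measure, forall x : R, u t x = u t (2 * lambda t - x)}.

Definition traveling_wave u : Prop :=
  exists (c : R) (U : R -> R), forall t x, 0 <= t -> u t x = U (x - c * t).

End HalfPlane.

(* Main.v *)
Require Import Defs.
From HB Require Import structures.
From mathcomp Require Import all_boot all_order all_algebra.
From mathcomp Require Import all_classical all_reals all_analysis.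
From mathcomp Require Import measurable_realfun ring lra.
Set Implicit Arguments.
Unset Strict Implicit.
Unset Printing Implicit Defensive.
Import Order.TTheory GRing.Theory Num.Theory.
Import numFieldNormedType.Exports.
Local Open Scope ring_scope.

(** A solution that stays symmetric about a moving axis must drift with it.
    Differentiating u(t,x) = u(t, 2 lambda(t) - x) in time gives
      u_t(t,x) = u_t(t,y) + 2 lambda'(t) u_x(t,y)   at y = 2 lambda(t) - x.
    Reflecting x multiplies P(d/dx) by a sign e and, under either parity
    assumption, multiplies F by - e.  After applying P(d/dx) and using the
    equation at x and at y, both sides are multiples of e and leave
      F(u)(t,y) = - lambda'(t) P(d/dx) u_x(t,y)         (symmetric_profile).
    For a fixed time s > 0 this says that the profile f = u(s,.), translated at
    constant speed c = lambda'(s), solves the equation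
    (traveling_is_solution).  The equation is autonomous, so t |-> u(s + t) is
    another solution with the same initial data, and uniqueness gives
      u(s + t, x) = u(s, x - lambda'(s) t)   for all t >= 0.

    The speed found this way depends on s, and s = 0 is excluded because the
    symmetry is only known at positive times.  Two different speeds for the same
    wave force the profile to be constant, in which case any speed will do
    (common_speed); and since u is continuous up to t = 0, letting s tend
    to 0 yields u(t,x) = u(0, x - c t)
    (traveling_wave_of_positive_times). *)

Section TravelingWaves.
Local Open Scope classical_set_scope.
Variable R : realType.
Implicit Types (f g : R -> R) (u v : R -> R -> R).

(** * One-variable calculus *)

Lemma is_derive1_quotient f (a l : R) :
  h^-1 * (f (h + a) - f a) @[h --> 0^'] --> l <-> is_derive a 1 f l.
Proof.
have E : (fun h : R => h^-1 * (f (h + a) - f a)) =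
    (fun h : R => h^-1 *: ((f \o shift a) (h *: (1 : R)) - f a)).
  by apply/funext => h /=; rewrite /GRing.scale /= mulr1.
rewrite E; split=> [H|H].
  by apply: DeriveDef; [apply/cvg_ex; exists l|apply: cvg_lim].
by have := @ex_derive _ _ _ _ _ _ _ H; rewrite -(@derive_val _ _ _ _ _ _ _ H).
Qed.

Lemma derivable_is_derive1 f (a : R) :
  derivable f a 1 -> is_derive a 1 f (derive1 f a).
Proof. by move=> df; apply: DeriveDef => //; rewrite derive1E. Qed.

Lemma is_derive1_val f (a l : R) : is_derive a 1 f l -> derive1 f a = l.
Proof. by move=> H; rewrite derive1E; exact: (@derive_val _ _ _ _ _ _ _ H). Qed.

Lemma is_derive1_derivable f (a l : R) : is_derive a 1 f l -> derivable f a 1.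
Proof. by case. Qed.

(** The set where two continuous functions differ is open, and a nonempty open
    set contains a ball, of positive measure. *)
Lemma continuous_ae_eq f g : continuous f -> continuous g ->
  {ae lebesgue_measure, forall x : R, f x = g x} -> f =1 g.
Proof.
move=> cf cg [B [mB B0 sB]] x; apply: contrapT => fgx.
have cfg : continuous (f \- g) by move=> y; apply: cvgB; [exact: cf|exact: cg].
have : \forall y \near x, (f \- g) y != 0.
  have ne0 : (f \- g) x != 0 by rewrite /= subr_eq0; apply/eqP.
  exact: (cfg x _ (open_nbhs_nbhs (conj (@open_neq R 0) ne0))).
case/nbhs_ballP => e /= e0 eB.
have : (lebesgue_measure (ball x e) <= lebesgue_measure B)%E.
  apply: le_measure; rewrite ?inE //; first exact: measurable_ball.
  move=> y /eB /= + ; rewrite subr_eq0 => /eqP fgy; exact: sB.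
rewrite B0 lebesgue_measure_ball; last exact: ltW.
by rewrite lee_fin leNgt pmulrn_lgt0// e0.
Qed.

Definition smooth f := forall i x, derivable (derive1n i f) x 1.

Lemma smooth_derive1 f : smooth f -> smooth (derive1 f).
Proof. by move=> sf i x; rewrite -derive1Sn; exact: sf. Qed.

Lemma smooth_continuous f : smooth f -> continuous f.
Proof.
move=> sf x; apply: differentiable_continuous.
exact/derivable1_diffP/(sf 0).
Qed.

Lemma is_derive_affine f (a b x : R) : derivable f (b * x + a) 1 ->
  is_derive x 1 (fun y => f (b * y + a)) (b * derive1 f (b * x + a)).
Proof.
move=> df.
have d1 : is_derive (b * x + a) 1 f (derive1 f (b * x + a)).
  exact: derivable_is_derive1.
have d2 : is_derive x 1 (fun y : R => b * y + a) b.
  by apply: is_derive_eq; rewrite addr0 /GRing.scale /= mulr1.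
rewrite mulrC; exact: (@is_derive1_comp _ f (fun y : R => b * y + a)).
Qed.

(** Treats translations (b = 1) and reflections (b = -1) at once. *)
Lemma derive1n_affine f (a b : R) i : smooth f ->
  derive1n i (fun y => f (b * y + a)) =
  fun y => b ^+ i * derive1n i f (b * y + a).
Proof.
move=> sf; elim: i => [|i IH]; first by apply/funext => y; rewrite mul1r.
rewrite derive1nS IH; apply/funext => y; rewrite derive1E.
have := @is_deriveZ _ _ _ _ (b ^+ i) _ _ _ (is_derive_affine (sf i (b * y + a))).
move=> H; have := @derive_val _ _ _ _ _ _ _ H.
rewrite derive1nS => ->; rewrite exprS /GRing.scale /=; ring.
Qed.

Lemma derive1n_translation f (a : R) i : smooth f ->
  derive1n i (fun y => f (y - a)) = fun y => derive1n i f (y - a).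
Proof.
move=> sf; have E (y : R) : y - a = 1 * y + - a by rewrite mul1r.
rewrite (funext (fun y => congr1 f (E y))) derive1n_affine//.
by apply/funext => y; rewrite expr1n mul1r -E.
Qed.

Lemma derive1n_reflection f (a : R) i : smooth f ->
  derive1n i (fun y => f (a - y)) = fun y => (-1) ^+ i * derive1n i f (a - y).
Proof.
move=> sf; have E (y : R) : a - y = -1 * y + a by rewrite mulN1r addrC.
rewrite (funext (fun y => congr1 f (E y))) derive1n_affine//.
by apply/funext => y; rewrite -E.
Qed.

Lemma derive1n_linear f g (a b : R) i : smooth f -> smooth g ->
  derive1n i (fun y => a * f y + b * g y) =
  fun y => a * derive1n i f y + b * derive1n i g y.
Proof.
move=> sf sg; elim: i => [//|i IH].
rewrite derive1nS IH; apply/funext => y; rewrite !derive1nS !derive1E.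
have H := @is_deriveD _ _ _ _ _ _ _ _ _
  (@is_deriveZ _ _ _ _ a _ _ _ (derivableP (sf i y)))
  (@is_deriveZ _ _ _ _ b _ _ _ (derivableP (sg i y))).
exact: (@derive_val _ _ _ _ _ _ _ H).
Qed.

Lemma smooth_linear f g (a b : R) :
  smooth f -> smooth g -> smooth (fun y => a * f y + b * g y).
Proof.
move=> sf sg i y; rewrite derive1n_linear//.
exact: (@ex_derive _ _ _ _ _ _ _ (@is_deriveD _ _ _ _ _ _ _ _ _
  (@is_deriveZ _ _ _ _ a _ _ _ (derivableP (sf i y)))
  (@is_deriveZ _ _ _ _ b _ _ _ (derivableP (sg i y))))).
Qed.

Lemma poly_diff_linear (P : {poly R}) f g (a b x : R) : smooth f -> smooth g ->
  poly_diff P (fun y => a * f y + b * g y) x =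
  a * poly_diff P f x + b * poly_diff P g x.
Proof.
move=> sf sg; rewrite /poly_diff !mulr_sumr -big_split /=.
by apply: eq_bigr => i _; rewrite derive1n_linear//; ring.
Qed.

(** * Parity of differential operators *)

(** The parity hypothesis concerns the polynomial function; it passes to the
    coefficients because P(-X) - e P vanishes at infinitely many points. *)
Lemma coef_parity (P : {poly R}) (e : R) (i : nat) :
  (forall x, P.[- x] = e * P.[x]) -> P`_i * (-1) ^+ i = e * P`_i.
Proof.
move=> HP; pose Q := P \Po (-1 *: 'X) - e *: P.
have Q0 : Q = 0.
  apply/eqP; apply: contraT => Qn0.
  (* A nonzero Q cannot vanish at the size Q points 0, 1, 2, ... *)
  have /(max_poly_roots Qn0) : all (root Q) [seq j%:R | j <- iota 0 (size Q)].
    apply/allP => y _; rewrite /root /Q hornerD hornerN hornerZ horner_comp.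
    by rewrite hornerZ hornerX mulN1r HP subrr.
  rewrite size_map size_iota ltnn => -> //.
  rewrite map_inj_uniq ?iota_uniq// => j k /eqP; rewrite eqr_nat => /eqP //.
have := congr1 (fun p : {poly R} => p`_i) Q0.
rewrite /Q coefB coefZ coef0 coef_comp_poly => /eqP; rewrite subr_eq0 => /eqP <-.
have [iP|iP] := ltnP i (size P).
  rewrite (bigD1 (Ordinal iP)) //= exprZn coefZ coefXn eqxx mulr1 big1 ?addr0//.
  move=> j ji; rewrite exprZn coefZ coefXn.
  by case: eqP => [E|]; rewrite ?mulr0//; case/eqP: ji; apply: val_inj.
rewrite nth_default// mul0r big1// => j _; rewrite exprZn coefZ coefXn.
case: eqP => [E|]; rewrite ?mulr0//.
by have := ltn_ord j; rewrite -E ltnNge iP.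
Qed.

Lemma poly_diff_translation (P : {poly R}) (a : R) f x : smooth f ->
  poly_diff P (fun y => f (y - a)) x = poly_diff P f (x - a).
Proof. by move=> sf; apply: eq_bigr => i _; rewrite derive1n_translation. Qed.

Lemma poly_diff_reflection (P : {poly R}) (e a : R) f x :
  (forall x, P.[- x] = e * P.[x]) -> smooth f ->
  poly_diff P (fun y => f (a - y)) x = e * poly_diff P f (a - x).
Proof.
move=> HP sf; rewrite /poly_diff mulr_sumr; apply: eq_bigr => i _.
by rewrite derive1n_reflection// !mulrA (coef_parity _ HP).
Qed.

Lemma jet_translation n (a : R) f x : smooth f ->
  jet n (fun y => f (y - a)) x = jet n f (x - a).
Proof. by move=> sf; apply/rowP => i; rewrite !mxE derive1n_translation. Qed.

Lemma jet_reflection n (a : R) f x : smooth f ->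
  jet n (fun y => f (a - y)) x = alternate_signs (jet n f (a - x)).
Proof. by move=> sf; apply/rowP => i; rewrite !mxE derive1n_reflection. Qed.

(** * Functions on the half-plane *)

Lemma time_incrementsE (t : R) : 0 < t -> time_increments t = 0^'.
Proof.
move=> t0; apply/seteqP; split=> A; rewrite /time_increments /within /=.
  move=> H; near=> h.
  have : (0 <= h + t) -> A h by near: h; exact: H.
  apply; near: h; apply: nbhs_dnbhs.
  exists t => //= h /=; rewrite sub0r normrN => ht.
  by move: ht; rewrite ltr_norml => /andP[? _]; lra.
by apply: filterS => h Ah _.
Unshelve. all: by end_near. Qed.

Local Instance time_increments_filter (t : R) : Filter (time_increments t).
Proof. exact: within_filter. Qed.

(** Positive increments are admissible at every t >= 0, also at the boundary, so
    limits of time quotients are unique. *)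
Lemma time_increments_proper (t : R) : 0 <= t ->
  ProperFilter (time_increments t).
Proof.
move=> t0; apply: Build_ProperFilter_ex => A HA.
apply: (@filter_ex _ (0 : R)^'+).
have {}HA : \forall h \near (0 : R), h != 0 -> 0 <= h + t -> A h by exact: HA.
suff: \forall h \near (0 : R), 0 < h -> A h by [].
apply: filterS HA => h Ah h0.
by apply: Ah; rewrite ?gt_eqF//= addr_ge0// ltW.
Qed.

Lemma time_quotient_cvg u t x (l : R) : 0 <= t ->
  time_quotient u t x h @[h --> time_increments t] --> l ->
  time_derivable u t x /\ time_derive u t x = l.
Proof.
move=> t0 H; have PF := time_increments_proper t0.
by split; [apply/cvg_ex; exists l|exact: cvg_lim H].
Qed.

Lemma time_derivable_cvg u t x : time_derivable u t x ->
  time_quotient u t x h @[h --> time_increments t] --> time_derive u t x.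
Proof. by []. Qed.

Lemma time_derive_ext u v t x :
  (forall s, 0 <= s -> u s x = v s x) -> 0 <= t -> time_derivable u t x ->
  time_derivable v t x /\ time_derive v t x = time_derive u t x.
Proof.
move=> uv t0 du; apply: time_quotient_cvg => //.
apply: cvg_trans (time_derivable_cvg du).
apply: near_eq_cvg.
suff: \forall h \near 0^', 0 <= h + t ->
  time_quotient u t x h = time_quotient v t x h by [].
by apply: nearW => h h0; rewrite /time_quotient !uv.
Qed.

Lemma continuous_halfplaneP u : continuous_halfplane u <->
  forall t x : R, 0 <= t ->
    u y.1 y.2 @[y --> within [set y : R * R | 0 <= y.1] (nbhs (t, x))]
      --> u t x.
Proof.
split=> [/subspace_continuousP cu t x t0|cu]; first exact: (cu (t, x)).
by apply/subspace_continuousP => -[t x] /= t0; exact: cu.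
Qed.

Lemma continuous_halfplane_ext u v :
  (forall t x : R, 0 <= t -> u t x = v t x) ->
  continuous_halfplane u -> continuous_halfplane v.
Proof.
move=> uv /continuous_halfplaneP cu; apply/continuous_halfplaneP => t x t0.
pose z : R * R := (t, x).
rewrite -uv//; apply: cvg_trans (cu t x t0); apply: near_eq_cvg.
suff: \forall y \near z, 0 <= y.1 -> u y.1 y.2 = v y.1 y.2 by [].
exact: (@filterE _ (nbhs z) _ _ (fun y => uv y.1 y.2)).
Qed.

Lemma C_halfplane_ext m u v :
  (forall t x : R, 0 <= t -> u t x = v t x) -> C_halfplane m u -> C_halfplane m v.
Proof.
elim: m u v => [|m IH] u v uv /= [cu D].
  by split=> //; exact: continuous_halfplane_ext cu.
case: D => dt dx ct cx.
have uvt t : 0 <= t -> u t = v t by move=> t0; apply/funext => x; exact: uv.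
split; first exact: continuous_halfplane_ext cu.
split=> [t x t0|t x t0||].
- exact: (time_derive_ext (fun s => uv s x) t0 (dt t x t0)).1.
- by rewrite /space_derivable -uvt//; exact: dx.
- apply: IH ct => t x t0.
  by rewrite (time_derive_ext (fun s => uv s x) t0 (dt t x t0)).2.
- by apply: IH cx => t x t0; rewrite /space_derive uvt.
Qed.

(** For s > 0 and t = 0 the increments allowed for the shifted function are
    one-sided while those for u at s are two-sided, hence restricting the filter
    rather than rewriting it. *)
Lemma time_shift_derive u (s t x : R) : 0 <= s -> 0 <= t ->
  time_derivable u (s + t) x ->
  time_derivable (fun t => u (s + t)) t x /\
  time_derive (fun t => u (s + t)) t x = time_derive u (s + t) x.
Proof.
move=> s0 t0 du; apply: time_quotient_cvg => //.
have -> : time_quotient (fun t => u (s + t)) t x = time_quotient u (s + t) x.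
  by apply/funext => h; rewrite /time_quotient addrCA.
apply: cvg_trans (time_derivable_cvg du); apply: cvg_app => A HA.
have {}HA : \forall h \near 0^', 0 <= h + (s + t) -> A h by exact: HA.
suff: \forall h \near 0^', 0 <= h + t -> A h by [].
by apply: filterS HA => h Ah h0; apply: Ah; rewrite /= addrCA addr_ge0.
Qed.

Lemma continuous_halfplane_time_shift u s : 0 <= s -> continuous_halfplane u ->
  continuous_halfplane (fun t => u (s + t)).
Proof.
move=> s0 /continuous_halfplaneP cu; apply/continuous_halfplaneP => t x t0.
pose z : R * R := (t, x).
apply: (@cvg_comp _ _ _ (fun y : R * R => (s + y.1, y.2))
  (fun y : R * R => u y.1 y.2) _ _ _ _ (cu (s + t) x (addr_ge0 s0 t0))) => A HA.
have {}HA : \forall y \near (s + t, x), 0 <= y.1 -> A y by exact: HA.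
have y1 : y.1 @[y --> z] --> t by exact: cvg_fst.
have y2 : y.2 @[y --> z] --> x by exact: cvg_snd.
have H : (s + y.1, y.2) @[y --> z] --> (s + t, x).
  exact: (cvg_pair (cvgD (cvg_cst s) y1) y2).
apply: (@filterS _ (nbhs z) _ _ _ _ (H _ HA)) => y Ay y0.
by apply: Ay; exact: addr_ge0.
Qed.

Lemma C_halfplane_time_shift m u s : 0 <= s -> C_halfplane m u ->
  C_halfplane m (fun t => u (s + t)).
Proof.
move=> s0; elim: m u => [|m IH] u /= [cu D].
  split=> //; exact: continuous_halfplane_time_shift.
case: D => dt dx ct cx; split; first exact: continuous_halfplane_time_shift.
split=> [t x t0|t x t0||].
- exact: (time_shift_derive s0 t0 (dt _ x (addr_ge0 s0 t0))).1.
- exact: dx (addr_ge0 s0 t0).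
- apply: C_halfplane_ext (IH _ ct) => t x t0.
  by rewrite (time_shift_derive s0 t0 (dt _ x (addr_ge0 s0 t0))).2.
- exact: IH _ cx.
Qed.

Lemma interior_halfplane (z : R * R) : 0 < z.1 ->
  nbhs z [set z : R * R | 0 <= z.1].
Proof.
move=> z0; exists ([set y | 0 < y], setT) => /=; last by move=> y [/ltW].
by split; [exact: lt_nbhsr|exact: filterT].
Qed.

Lemma continuous_halfplane_interior u (t x : R) : continuous_halfplane u ->
  0 < t -> u y.1 y.2 @[y --> (t, x)] --> u t x.
Proof.
move=> /continuous_halfplaneP cu t0; have := cu t x (ltW t0).
by rewrite within_interior//; exact: interior_halfplane.
Qed.

Lemma C_halfplane_smooth m u t : 0 <= t -> C_halfplane m u ->
  forall i x, (i < m)%N -> derivable (derive1n i (u t)) x 1.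
Proof.
move=> t0; elim: m u => [//|m IH] u [_ [_ dx _ cx]] [|i] x im; first exact: dx.
by rewrite derive1Sn; exact: IH cx i x im.
Qed.

Lemma smooth_halfplane_slice u t : smooth_halfplane u -> 0 <= t -> smooth (u t).
Proof. by move=> su t0 i x; exact: (C_halfplane_smooth t0 (su i.+1)). Qed.

Lemma smooth_halfplane_derive u : smooth_halfplane u ->
  smooth_halfplane (time_derive u) /\ smooth_halfplane (space_derive u).
Proof. by move=> su; split=> m; have [_ []] := su m.+1. Qed.

(** The factor k makes the class of functions k f(x - c t) stable under both
    partial derivatives, which lets smoothness be proved by induction. *)
Lemma traveling_time_derive f (k c t x : R) : smooth f -> 0 <= t ->
  time_derivable (fun t x => k * f (x - c * t)) t x /\
  time_derive (fun t x => k * f (x - c * t)) t x =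
    - (c * k) * derive1 f (x - c * t).
Proof.
move=> sf t0; apply: time_quotient_cvg => //; apply: cvg_within_filter.
have affE s : x - c * s = - c * s + x by rewrite mulNr addrC.
have H := @is_deriveZ _ _ _ _ k _ _ _
  (is_derive_affine (sf 0 (- c * t + x))).
have -> : time_quotient (fun t x => k * f (x - c * t)) t x = fun h => h^-1 *
    ((k *: (fun t => f (- c * t + x))) (h + t) -
     (k *: (fun t => f (- c * t + x))) t).
  by apply/funext => h; rewrite /time_quotient !affE.
apply/is_derive1_quotient; apply: is_derive_eq.
by rewrite affE /GRing.scale /=; ring.
Qed.

Lemma C_halfplane_traveling m f (k c : R) : smooth f ->
  C_halfplane m (fun t x => k * f (x - c * t)).
Proof.
elim: m f k => [|m IH] f k sf.
all: have cf : continuous_halfplane (fun t x => k * f (x - c * t)).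
1,3: apply: continuous_subspaceT => z; apply: cvgM; first exact: cvg_cst.
1,2: apply: continuous_comp; last exact: smooth_continuous.
1,2: apply: cvgB; [exact: cvg_snd|apply: cvgM; [exact: cvg_cst|exact: cvg_fst]].
  by [].
have dx (t x : R) : is_derive x 1 (fun x => k * f (x - c * t))
    (k * derive1 f (x - c * t)).
  have H := @is_deriveZ _ _ _ _ k _ _ _
    (is_derive_affine (sf 0 (1 * x + - (c * t)))).
  rewrite !mul1r in H.
  have -> : (fun x => k * f (x - c * t)) = k *: (fun x => f (1 * x - c * t)).
    by apply/funext => y; rewrite -[y in LHS]mul1r.
  exact: H.
split=> //; split=> [t x t0|t x t0||].
- exact: (traveling_time_derive k c x sf t0).1.
- exact: (@ex_derive _ _ _ _ _ _ _ (dx t x)).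
- apply: (@C_halfplane_ext _ (fun t x => - (c * k) * derive1 f (x - c * t))).
    by move=> t x t0; rewrite (traveling_time_derive k c x sf t0).2.
  exact: IH (smooth_derive1 sf).
- apply: (@C_halfplane_ext _ (fun t x => k * derive1 f (x - c * t))).
    by move=> t x t0; rewrite /space_derive (is_derive1_val (dx t x)).
  exact: IH (smooth_derive1 sf).
Qed.

Lemma time_derivable_is_derive u (t x : R) : 0 < t -> time_derivable u t x ->
  is_derive t 1 (u^~ x) (time_derive u t x).
Proof.
move=> t0 du; apply/is_derive1_quotient.
by have := time_derivable_cvg du; rewrite time_incrementsE.
Qed.

Lemma time_quotient_MVT u (t h x : R) :
  (forall s, 0 < s -> time_derivable u s x) -> h != 0 -> `|h| < t ->
  exists2 c, `|t - c| <= `|h| &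
    h^-1 * (u (h + t) x - u t x) = time_derive u c x.
Proof.
move=> du h0 ht.
have MVT (a b : R) : 0 < a -> a <= b -> exists2 c, a <= c <= b &
    u b x - u a x = time_derive u c x * (b - a).
  move=> a0 ab; case: (@MVT_segment _ (u^~ x) (time_derive u ^~ x) a b ab).
  - move=> s; rewrite in_itv /= => /andP[lt_as _].
    have s0 : 0 < s := lt_trans a0 lt_as.
    exact: time_derivable_is_derive s0 (du s s0).
  - apply: derivable_within_continuous => s; rewrite in_itv /= => /andP[le_as _].
    have s0 : 0 < s := lt_le_trans a0 le_as.
    exact: is_derive1_derivable (time_derivable_is_derive s0 (du s s0)).
  - by move=> c; rewrite in_itv /= => cab E; exists c.
have [hneg|hpos] := ltP h 0.
  rewrite ltr0_norm// in ht *.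
  have [||c /andP[c1 c2] E] := MVT (h + t) t; [lra|lra|].
  exists c; first by rewrite ger0_norm; lra.
  apply: (mulfI h0); rewrite mulVKf//.
  by rewrite -[LHS]opprB E; ring.
have {}hpos : 0 < h by rewrite lt_neqAle eq_sym h0.
rewrite gtr0_norm// in ht *.
have [||c /andP[c1 c2] E] := MVT t (h + t); [lra|lra|].
exists c; first by rewrite ler0_norm; lra.
by apply: (mulfI h0); rewrite mulVKf// E; ring.
Qed.

(** Chain rule for a function known only to have continuous partial derivatives.
    The increment is split through (t, g (t + h)): its time part is u_t at an
    intermediate time, where the joint continuity of u_t applies, and its space
    part is an ordinary composition. *)
Lemma is_derive_along_curve u g (t : R) : C_halfplane 1 u -> 0 < t ->
  derivable g t 1 ->
  is_derive t 1 (fun s => u s (g s))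
    (time_derive u t (g t) + derive1 g t * space_derive u t (g t)).
Proof.
move=> [_ [dt dx [ct _] _]] t0 dg; apply/is_derive1_quotient.
have cg : g h @[h --> t] --> g t.
  exact/differentiable_continuous/derivable1_diffP.
have space_part : h^-1 * (u t (g (h + t)) - u t (g t)) @[h --> 0^']
    --> derive1 g t * space_derive u t (g t).
  apply/(is_derive1_quotient (u t \o g)); rewrite mulrC.
  have dut : is_derive (g t) 1 (u t) (space_derive u t (g t)).
    exact: derivable_is_derive1 (dx t (g t) (ltW t0)).
  have dgt : is_derive t 1 g (derive1 g t).
    exact: derivable_is_derive1.
  exact: is_derive1_comp.
suff time_part : h^-1 * (u (h + t) (g (h + t)) - u t (g (h + t)))
    @[h --> 0^'] --> time_derive u t (g t).
  have quotientE h : h^-1 * (u (h + t) (g (h + t)) - u t (g t)) =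
      h^-1 * (u (h + t) (g (h + t)) - u t (g (h + t))) +
      h^-1 * (u t (g (h + t)) - u t (g t)) by ring.
  under eq_fun do rewrite quotientE.
  exact: cvgD.
apply/cvgrPdist_lt => e e0.
have /cvgrPdist_lt /(_ e e0) := continuous_halfplane_interior (x := g t) ct t0.
move=> [[A B] /= [At Bg] AB].
case/nbhs_ballP: At => d /= d0 dA.
have gB : \forall s \near t, B (g s) := cg _ Bg.
case/nbhs_ballP: gB => d' /= d'0 d'B.
near=> h.
have hd : `|h| < Num.min (Num.min d d') t.
  near: h; apply: dnbhs0_lt.
  by rewrite !lt_min d0 d'0.
move: hd; rewrite !lt_min => /andP[/andP[hd hd'] ht].
have h0 : h != 0 by near: h; exact: nbhs_dnbhs_neq.
have [c ch ->] := time_quotient_MVT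
  (fun s s0 => dt s (g (h + t)) (ltW s0)) h0 ht.
apply: (AB (c, g (h + t))); split => /=.
  by apply: dA; exact: le_lt_trans hd.
by apply: d'B; rewrite /ball /= opprD addrCA subrr addr0 normrN.
Unshelve. all: by end_near. Qed.

(** * The profile equation *)

Lemma traveling_is_solution (P : {poly R}) n (F : 'rV[R]_n.+1 -> R) f (c : R) :
  smooth f ->
  (forall y, F (jet n f y) = - c * poly_diff P (derive1 f) y) ->
  classical_solution P F (fun t x => f (x - c * t)).
Proof.
move=> sf profile.
have f1 : (fun t x => f (x - c * t)) = (fun t x => 1 * f (x - c * t)).
  by apply/funext => t; apply/funext => x; rewrite mul1r.
split=> [m|t x t0]; first by rewrite f1; exact: C_halfplane_traveling.
(* The combination with coefficients 0 and - c is the multiple - c f'. *)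
pose g z := 0 * f z + - c * derive1 f z.
have sg : smooth g by exact: smooth_linear sf (smooth_derive1 sf).
have -> : time_derive (fun t x => f (x - c * t)) t = (fun x => g (x - c * t)).
  apply/funext => y; rewrite f1 (traveling_time_derive 1 c y sf t0).2.
  by rewrite mulr1 /g mul0r add0r.
rewrite poly_diff_translation// poly_diff_linear//; last exact: smooth_derive1.
by rewrite mul0r add0r jet_translation// profile.
Qed.

Lemma solution_time_shift (P : {poly R}) n (F : 'rV[R]_n.+1 -> R) u s :
  0 <= s -> classical_solution P F u ->
  classical_solution P F (fun t => u (s + t)).
Proof.
move=> s0 [su eq]; split=> [m|t x t0]; first exact: C_halfplane_time_shift.
rewrite -eq ?addr_ge0//; congr poly_diff; apply/funext => y.
have [_ [dt _ _ _]] := su 1%N.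
by rewrite (time_shift_derive s0 t0 (dt _ y (addr_ge0 s0 t0))).2.
Qed.

(** The sign e is 1 when P is even and -1 when P is odd. *)
Lemma symmetric_profile (P : {poly R}) n (F : 'rV[R]_n.+1 -> R) u
    (e : R) (lambda : R -> R) (t : R) :
  e != 0 -> (forall x, P.[- x] = e * P.[x]) ->
  (forall a, F (alternate_signs a) = - e * F a) ->
  classical_solution P F u -> 0 < t -> derivable lambda t 1 ->
  (forall s x, 0 < s -> u s x = u s (2 * lambda s - x)) ->
  forall y, F (jet n (u t) y) =
            - derive1 lambda t * poly_diff P (derive1 (u t)) y.
Proof.
move=> e0 HP HF [su equ] t0 dl sym y.
have [sdt sdx] := smooth_halfplane_derive su.
have [_ [dt _ _ _]] := su 1%N.
have sdut := smooth_halfplane_slice sdt (ltW t0).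
have sdux := smooth_halfplane_slice sdx (ltW t0).
pose k := 2 * derive1 lambda t.
pose h z := 1 * time_derive u t z + k * space_derive u t z.
have sh : smooth h by exact: smooth_linear sdut sdux.
have utE : time_derive u t = (fun x => h (2 * lambda t - x)).
  apply/funext => x.
  have H1 : is_derive t 1 (fun s => u s x) (time_derive u t x).
    exact: time_derivable_is_derive t0 (dt t x (ltW t0)).
  have dg : is_derive t 1 (fun s => 2 * lambda s - x) k.
    have dl1 : is_derive t 1 lambda (derive1 lambda t).
      exact: derivable_is_derive1.
    have := @is_deriveB _ _ _ _ _ _ _ _ _
      (@is_deriveZ _ _ _ _ (2:R) _ _ _ dl1) (is_derive_cst x t 1).
    by rewrite subr0.
  have H2 := is_derive_along_curve (su 1%N) t0 (is_derive1_derivable dg).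
  rewrite (is_derive1_val dg) -[X in X + _]mul1r in H2.
  rewrite -(is_derive1_val H1) /h -(is_derive1_val H2) !derive1E.
  apply: near_eq_derive.
  near=> s; apply: sym; near: s; exact: lt_nbhsr.
have utx : u t = fun x => u t (2 * lambda t - x).
  by apply/funext => x; exact: sym.
(* The equation is read at the mirror image x of y. *)
pose x := 2 * lambda t - y.
have xy : 2 * lambda t - x = y by rewrite /x; ring.
have := equ t x (ltW t0).
rewrite {1}utE (poly_diff_reflection _ _ HP)//.
rewrite xy poly_diff_linear// equ ?ltW//.
rewrite {2}utx jet_reflection; last exact: smooth_halfplane_slice su (ltW t0).
rewrite xy HF => E.
have : e * (2 * (F (jet n (u t) y) +
  derive1 lambda t * poly_diff P (derive1 (u t)) y)) = 0.
  rewrite -[derive1 (u t)]/(space_derive u t).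
  move/eqP: E; rewrite -subr_eq0 => /eqP; rewrite /k => <-; ring.
move/eqP; rewrite !mulf_eq0 (negPf e0) pnatr_eq0 /= addr_eq0 => /eqP ->.
by rewrite mulNr.
Unshelve. all: by end_near. Qed.

(** * From positive times to a single speed *)

Lemma traveling_wave_of_positive_times u (c : R) : continuous_halfplane u ->
  (forall s t x, 0 < s -> 0 <= t -> u (s + t) x = u s (x - c * t)) ->
  traveling_wave u.
Proof.
move=> /continuous_halfplaneP cu wave; exists c, (u 0) => t x.
rewrite le_eqVlt => /predU1P[<-|t0]; first by rewrite mulr0 subr0.
(* The characteristic line through (t, x), followed down to time 0. *)
pose z (s : R) : R * R := (s, x - c * (t - s)).
have s_to0 : s @[s --> (0 : R)^'+] --> (0 : R) by exact: cvg_within.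
have z0 : z s @[s --> 0^'+] --> (0, x - c * t).
  rewrite -[t in _ --> (_, x - c * t)]subr0.
  exact: (cvg_pair s_to0
    (cvgB (cvg_cst x) (cvgM (cvg_cst c) (cvgB (cvg_cst t) s_to0)))).
have lim1 : u (z s).1 (z s).2 @[s --> 0^'+] --> u 0 (x - c * t).
  apply: (@cvg_comp _ _ _ z (fun y : R * R => u y.1 y.2) _ _ _ _
    (cu 0 (x - c * t) (lexx 0))) => A HA.
  have {}HA : \forall y \near (0 : R, x - c * t), 0 <= y.1 -> A y by exact: HA.
  suff: \forall s \near 0^'+, A (z s) by [].
  have Az : \forall s \near 0^'+, 0 <= (z s).1 -> A (z s) by exact: (z0 _ HA).
  near=> s; have : 0 <= (z s).1 -> A (z s) by near: s.
  by apply; rewrite /= ltW.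
have const s : 0 < s -> s <= t -> u t x = u (z s).1 (z s).2.
  by move=> s0 st; rewrite /= -wave ?subr_ge0// subrKC.
suff H : u (z s).1 (z s).2 @[s --> 0^'+] --> u t x.
  exact: (cvg_unique _ H lim1).
have cst_lim : u t x @[_ --> (0 : R)^'+] --> u t x by exact: cvg_cst.
apply: cvg_trans cst_lim; apply: near_eq_cvg.
near=> s; apply: const => //; near: s; exact: nbhs_right_le.
Unshelve. all: by end_near. Qed.

(** The hypothesis makes f invariant under the shifts (a - b) t with t >= 0, which
    carry one of any two given points to the other. *)
Lemma two_speeds_constant f (a b : R) : a != b ->
  (forall t x, 0 <= t -> f (x - a * t) = f (x - b * t)) ->
  forall y z, f y = f z.
Proof.
move=> ab fab; have ab0 : a - b != 0 by rewrite subr_eq0.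
have le_case y z : 0 <= (z - y) / (a - b) -> f y = f z.
  move=> t0; have := fab _ (y + a * ((z - y) / (a - b))) t0.
  rewrite addrK => ->; congr f.
  by rewrite -addrA -mulrBl mulrCA divff// mulr1 addrC subrK.
move=> y z; have [/le_case//|lt0] := leP 0 ((z - y) / (a - b)).
by apply/esym/le_case; rewrite -opprB mulNr oppr_ge0 ltW.
Qed.

(** From time 1 on, the speed c 1 governs every later time.  An earlier time s
    whose speed differs makes the profile at time 1 move at two speeds, so that
    it is constant, and then so is the profile at time s, a translate of it. *)
Lemma common_speed u (c : R -> R) :
  (forall s t x : R, 0 < s -> 0 <= t -> u (s + t) x = u s (x - c s * t)) ->
  forall s t x : R, 0 < s -> 0 <= t -> u (s + t) x = u s (x - c 1 * t).
Proof.
move=> wave s t x s0 t0.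
have wave_from r q y : 0 < r -> r <= q -> u q y = u r (y - c r * (q - r)).
  by move=> r0 rq; rewrite -wave ?subr_ge0// subrKC.
have [s1|s1] := leP 1 s.
  rewrite (wave_from 1 (s + t)) ?ltr01 ?(le_trans s1) ?lerDl//.
  by rewrite (wave_from 1 s)//; congr (u 1 _); ring.
have [<-|cs] := eqVneq (c s) (c 1); first exact: wave.
have const1 : forall y z, u 1 y = u 1 z.
  apply: two_speeds_constant cs _ => r y r0.
  rewrite -(wave 1)// (wave_from s 1 _ s0 (ltW s1)).
  rewrite (wave_from s (1 + r))//; first by congr (u s _); ring.
  by rewrite ler_wpDr// ltW.
have us y : u s y = u 1 (y + c s * (1 - s)).
  by rewrite (wave_from s 1 _ s0 (ltW s1)) addrK.
by rewrite wave// !us; exact: const1.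
Qed.

Lemma x_symmetric_everywhere u : smooth_halfplane u -> x_symmetric u ->
  exists2 lambda : R -> R, (forall t, 0 < t -> derivable lambda t 1) &
    forall t x, 0 < t -> u t x = u t (2 * lambda t - x).
Proof.
move=> su [lambda [dl _] sym]; exists lambda => [t t0|t x t0].
  by apply: dl; rewrite in_itv /= t0.
have cut := smooth_continuous (smooth_halfplane_slice su (ltW t0)).
apply: (continuous_ae_eq cut _ (sym t t0)) => y.
apply: continuous_comp; last exact: cut.
by apply: cvgB; [exact: cvg_cst|exact: cvg_id].
Qed.

End TravelingWaves.

Theorem theorem2p2 (R : realType) (P : {poly R}) (n : nat)
    (F : 'rV[R]_n.+1 -> R)
    (uniqueness : unique_classical_solutions P F)
    (parity :
      (even_polynomial P /\
         forall a : 'rV[R]_n.+1, F (alternate_signs a) = - F a) \/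
      (odd_polynomial P /\
         forall a : 'rV[R]_n.+1, F (alternate_signs a) = F a))
    (u : R -> R -> R)
    (u_solution : classical_solution P F u)
    (u_symmetric : x_symmetric u) :
  traveling_wave u.
Proof.
(* Both parity assumptions are one statement about a sign e. *)
have [e [e0 HP HF]] : exists e : R, [/\ e != 0,
    forall x, P.[- x] = e * P.[x] &
    forall a, F (alternate_signs a) = - e * F a].
  case: parity => -[HP HF].
    by exists 1; split=> [|x|a]; rewrite ?oner_eq0// ?HP ?HF ?mul1r// mulN1r.
  exists (-1); split=> [|x|a]; first by rewrite oppr_eq0 oner_eq0.
  - by rewrite HP mulN1r.
  - by rewrite HF opprK mul1r.
have [su equ] := u_solution.
have [lambda dl sym] := x_symmetric_everywhere su u_symmetric.
have wave s t x : 0 < s -> 0 <= t ->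
    u (s + t) x = u s (x - derive1 lambda s * t).
  move=> s0 t0.
  have profile := symmetric_profile e0 HP HF u_solution s0 (dl s s0)
    (fun r y => sym r y).
  have sol := traveling_is_solution
    (smooth_halfplane_slice su (ltW s0)) profile.
  apply: (uniqueness _ _ (solution_time_shift (ltW s0) u_solution) sol) => //.
  by move=> y; rewrite addr0 mulr0 subr0.
have [cu _] := su 0.
exact: traveling_wave_of_positive_times cu (common_speed wave).
Qed.
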